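(* Let $G$ be a finite group, $S$ a normal abelian subgroup of $G$ and $\eta\in\mathrm{Z}^2(S,k^\times)$ a non-degenerate $2$-cocycle, i.e. $\langle s,t\rangle:=\eta(s,t)\eta(t,s)^{-1}$ is a non-degenerate bimultiplicative symplectic form on $S$. Assume further that $\eta(s,s^{-1})=1$ for all $s\in S$. Define $\alpha:k^G\otimes k^G\to k$ by $$\alpha(f,f')=\frac{1}{|S|^2}\sum_{r,t,r',t'\in S}\eta(t,t')\,\langle t,r\rangle\,\langle t',r'\rangle\, f(r)\,f'(r').$$ Then $\alpha\in\mathrm{Z}^2(k^G)$ and there is an isomorphism of $k^G$-comodule algebras between the twisted algebra ${}_\alpha(k^G)$ and $R(S,\eta)$.
   Context: $k$ is an algebraically closed field of characteristic zero. $k^G$ is the Hopf algebra of functions on $G$ with $f_1(g)f_2(h)=f(gh)$ (Sweedler notation $\Delta(f)=f_1\otimes f_2$). For a Hopf algebra $H$, $\mathrm{Z}^2(H)$ is the set of convolution invertible linear $\sigma:H\otimes H\to k$ with $\sigma(1,h)=\epsilon(h)=\sigma(h,1)$ and $\sigma(a_1,b_1)\sigma(a_2b_2,c)=\sigma(b_1,c_1)\sigma(a,b_2c_2)$. For $\sigma\in\mathrm{Z}^2(H)$, ${}_\sigma H$ is the right $H$-comodule algebra which is $H$ as an $H$-comodule (via the coproduct) with product $a\cdot_\sigma b=\sigma(a_1,b_1)a_2b_2$. For $\eta\in\mathrm{Z}^2(S,k^\times)$ the (normalized) twisted group algebra $k_\eta S$ has basis $S$, product $g\cdot h=\eta(g,h)gh$,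 and left $S$-action $g.h=g\cdot h\cdot g^{-1}$ (conjugation by $g$ inside the algebra $k_\eta S$). Then $$R(S,\eta):=\{r:G\to k_\eta S\mid r(sg)=s.r(g)\ \forall s\in S,\ g\in G\}$$ with pointwise multiplication and $G$-action $(g.r)(h)=r(hg)$, equivalently the $k^G$-coaction $\delta(r)=\sum_{g\in G}e_g\otimes g.r$, where $e_g$ is the basis of $k^G$ dual to $G$. *)

(* Defs.v *)
From HB Require Import structures.
From mathcomp Require Import all_boot all_order all_algebra all_fingroup.

Set Implicit Arguments.
Unset Strict Implicit.
Unset Printing Implicit Defensive.

Import GRing.Theory.
Local Open Scope ring_scope.

(* A list [:: (u_1, v_1); ...; (u_n, v_n)] stands for the element              *)
(* u_1 (x) v_1 + ... + u_n (x) v_n of the tensor product of U and V over k;    *)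
(* two lists denote the same tensor iff every bilinear map agrees on them      *)
(* (universal property), which is the relation s =t t below.  The Sweedler     *)
(* notation a_1 (x) a_2 becomes p.1 (x) p.2 with p ranging over cop a.         *)
Section Tensor.
Variable k : fieldType.

Definition bilinear_map (U V X : lmodType k) (b : U -> V -> X) : Prop :=
  (forall v, linear (b^~ v)) /\ (forall u, linear (b u)).

Definition trilinear_map (U V W X : lmodType k) (t : U -> V -> W -> X) : Prop :=
  [/\ forall v w, linear (fun u => t u v w),
      forall u w, linear (fun v => t u v w)
    & forall u v, linear (fun w => t u v w)].

Definition teq (U V : lmodType k) (s t : seq (U * V)) : Prop :=
  forall (X : lmodType k) (b : U -> V -> X), bilinear_map b ->
    \sum_(p <- s) b p.1 p.2 = \sum_(p <- t) b p.1 p.2.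

Definition tmap (U V U' V' : lmodType k) (f : U -> U') (g : V -> V')
    (s : seq (U * V)) : seq (U' * V') :=
  [seq (f p.1, g p.2) | p <- s].

Definition tmul (A B : algType k) (s t : seq (A * B)) : seq (A * B) :=
  [seq (p.1 * q.1, p.2 * q.2) | p <- s, q <- t].

Definition tlinear (W U V : lmodType k) (D : W -> seq (U * V)) : Prop :=
  forall c x y, teq (D (c *: x + y)) (tmap ( *:%R c) id (D x) ++ D y).

(* (d (x) id) o d = (id (x) D) o d, as elements of A (x) H (x) H.              *)
Definition coassociative (A H : lmodType k)
    (D : H -> seq (H * H)) (d : A -> seq (A * H)) : Prop :=
  forall (a : A) (X : lmodType k) (t : A -> H -> H -> X), trilinear_map t ->
    \sum_(p <- d a) \sum_(q <- d p.1) t q.1 q.2 p.2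
    = \sum_(p <- d a) \sum_(q <- D p.2) t p.1 q.1 q.2.

End Tensor.

Notation "s =t t" := (teq s t) (at level 70, no associativity).

Section Hopf.
Variable k : fieldType.

Record hopfAlg := HopfAlg {
  hopf_sort :> algType k;
  cop : hopf_sort -> seq (hopf_sort * hopf_sort);
  counit : hopf_sort -> k;
  antipode : hopf_sort -> hopf_sort;
  cop_linear : tlinear cop;
  copM : forall a b, cop (a * b) =t tmul (cop a) (cop b);
  cop1 : cop 1 =t [:: (1, 1)];
  counit_linear : linear (counit : hopf_sort -> k^o);
  counitM : forall a b, counit (a * b) = counit a * counit b;
  counit1 : counit 1 = 1;
  antipode_linear : linear antipode;
  cop_coassoc : coassociative cop cop;
  cop_counitl : forall a, \sum_(p <- cop a) counit p.1 *: p.2 = a;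
  cop_counitr : forall a, \sum_(p <- cop a) counit p.2 *: p.1 = a;
  antipodel : forall a, \sum_(p <- cop a) antipode p.1 * p.2 = counit a *: 1;
  antipoder : forall a, \sum_(p <- cop a) p.1 * antipode p.2 = counit a *: 1
}.

Record comodAlg (H : hopfAlg) := ComodAlg {
  comod_sort :> algType k;
  coact : comod_sort -> seq (comod_sort * H);
  coact_linear : tlinear coact;
  coactM : forall a b, coact (a * b) =t tmul (coact a) (coact b);
  coact1 : coact 1 =t [:: (1, 1)];
  coact_coassoc : coassociative (@cop H) coact;
  coact_counit : forall a, \sum_(p <- coact a) counit p.2 *: p.1 = a
}.

Definition comodAlg_iso (H : hopfAlg) (A B : comodAlg H) : Prop :=
  exists2 phi : {lrmorphism A -> B}, bijective phi &
    forall a : A, tmap phi id (coact a) =t coact (phi a).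

Section Cocycles.
Variable H : hopfAlg.

Definition conv (s t : H -> H -> k) (a b : H) : k :=
  \sum_(p <- cop a) \sum_(q <- cop b) s p.1 q.1 * t p.2 q.2.

(* s is in Z^2(H); linear forms on H (x) H are bilinear forms on H.            *)
Record hopf_cocycle (s : H -> H -> k) : Prop := HopfCocycle {
  hc_bilinear : bilinear_map (s : H -> H -> k^o);
  hc_inv : exists2 t : H -> H -> k, bilinear_map (t : H -> H -> k^o) &
    forall a b, conv s t a b = counit a * counit b
             /\ conv t s a b = counit a * counit b;
  hc_1l : forall a, s 1 a = counit a;
  hc_1r : forall a, s a 1 = counit a;
  hc_assoc : forall a b c,
    \sum_(p <- cop a) \sum_(q <- cop b) s p.1 q.1 * s (p.2 * q.2) c
    = \sum_(p <- cop b) \sum_(q <- cop c) s p.1 q.1 * s a (p.2 * q.2)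
}.

Definition twisted (s : H -> H -> k) (hs : hopf_cocycle s) : Type := H.

End Cocycles.

Lemma lin0 (U X : lmodType k) (f : U -> X) : linear f -> f 0 = 0.
Proof.
by move=> fl; have := fl (-1) 0 0; rewrite scaler0 addr0 scaleN1r addNr.
Qed.

Lemma linZE (U X : lmodType k) (f : U -> X) c x : linear f -> f (c *: x) = c *: f x.
Proof. by move=> fl; have := fl c x 0; rewrite (lin0 fl) !addr0. Qed.

Lemma lin_sumE (U X : lmodType k) (f : U -> X) I (r : seq I) (g : I -> U) :
  linear f -> f (\sum_(i <- r) g i) = \sum_(i <- r) f (g i).
Proof.
move=> fl; elim: r => [|i r IH]; first by rewrite !big_nil lin0.
by rewrite !big_cons -[g i]scale1r fl scale1r IH scale1r.
Qed.

Lemma lin_sum (U X : lmodType k) I (r : seq I) (f : I -> U -> X) :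
  (forall i, linear (f i)) -> linear (fun x => \sum_(i <- r) f i x).
Proof.
move=> fl c x y; rewrite scaler_sumr -big_split /=.
by apply: eq_bigr => i _; rewrite fl.
Qed.

Lemma lin_scalel (U X : lmodType k) (f : U -> k) (v : X) :
  linear (f : U -> k^o) -> linear (fun x => f x *: v).
Proof. by move=> fl c x y; rewrite fl scalerDl -scalerA. Qed.

Lemma lin_scaler (U X : lmodType k) (f : U -> X) (d : k) :
  linear f -> linear (fun x => d *: f x).
Proof. by move=> fl c x y; rewrite fl scalerDr !scalerA mulrC. Qed.

Lemma lin_mull (U : lmodType k) (A : algType k) (f : U -> A) (v : A) :
  linear f -> linear (fun x => f x * v).
Proof. by move=> fl c x y; rewrite fl mulrDl scalerAl. Qed.

Lemma lin_mulr (U : lmodType k) (A : algType k) (f : U -> A) (v : A) :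
  linear f -> linear (fun x => v * f x).
Proof. by move=> fl c x y; rewrite fl mulrDr scalerAr. Qed.

Lemma lin_id (U : lmodType k) : linear (fun x : U => x).
Proof. by []. Qed.

Lemma lin_bill (U V W X : lmodType k) (b : V -> W -> X) (f : U -> V) w :
  bilinear_map b -> linear f -> linear (fun x => b (f x) w).
Proof. by move=> [bl _] fl c x y; rewrite fl bl. Qed.

Lemma lin_bilr (U V W X : lmodType k) (b : V -> W -> X) (f : U -> W) v :
  bilinear_map b -> linear f -> linear (fun x => b v (f x)).
Proof. by move=> [_ bl] fl c x y; rewrite fl bl. Qed.

Lemma lin_D (W U V X : lmodType k) (D : W -> seq (U * V)) (b : U -> V -> X) :
  tlinear D -> bilinear_map b -> linear (fun x => \sum_(p <- D x) b p.1 p.2).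
Proof.
move=> Dl bl c x y; rewrite (Dl c x y X b bl) big_cat big_map scaler_sumr /=.
congr (_ + _); apply: eq_bigr => p _.
have b0 : b 0 p.2 = 0 := lin0 (bl.1 p.2).
by have := bl.1 p.2 c p.1 0; rewrite !addr0 b0 addr0.
Qed.

Section Twist.
Variables (H : hopfAlg) (s : H -> H -> k) (hs : hopf_cocycle s).
Let sb := hc_bilinear hs.

Definition twmul (a b : H) : H :=
  \sum_(p <- cop a) \sum_(q <- cop b) s p.1 q.1 *: (p.2 * q.2).

Lemma twmulDl c x y b : twmul (c *: x + y) b = c *: twmul x b + twmul y b.
Proof.
apply: (lin_D (b := fun u v => \sum_(q <- cop b) s u q.1 *: (v * q.2))).
  exact: cop_linear.
split=> v; apply: lin_sum => q.
  by apply: lin_scalel; apply: (lin_bill _ sb); exact: lin_id.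
by apply: lin_scaler; apply: lin_mull; exact: lin_id.
Qed.

Lemma twmulE2 a b :
  twmul a b = \sum_(q <- cop b) \sum_(p <- cop a) s p.1 q.1 *: (p.2 * q.2).
Proof. exact: exchange_big. Qed.

Lemma twmulDr c a x y : twmul a (c *: x + y) = c *: twmul a x + twmul a y.
Proof.
rewrite !twmulE2.
apply: (lin_D (b := fun u v => \sum_(p <- cop a) s p.1 u *: (p.2 * v))).
  exact: cop_linear.
split=> v; apply: lin_sum => q.
  by apply: lin_scalel; apply: (lin_bilr _ sb); exact: lin_id.
by apply: lin_scaler; apply: lin_mulr; exact: lin_id.
Qed.

Lemma twmul_bilinear : bilinear_map twmul.
Proof. by split=> b c x y; rewrite ?twmulDl ?twmulDr. Qed.

Lemma cop_mul_sum (X : lmodType k) (b : H -> H -> X) x y : bilinear_map b ->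
  \sum_(u <- cop (x * y)) b u.1 u.2
  = \sum_(p <- cop x) \sum_(q <- cop y) b (p.1 * q.1) (p.2 * q.2).
Proof. by move=> bl; rewrite (copM x y bl) big_allpairs_dep. Qed.

Lemma twmulMl x y c :
  twmul (x * y) c = \sum_(p <- cop x) \sum_(q <- cop y) \sum_(r <- cop c)
     s (p.1 * q.1) r.1 *: (p.2 * q.2 * r.2).
Proof.
apply: (cop_mul_sum (b := fun u v => \sum_(r <- cop c) s u r.1 *: (v * r.2))).
split=> v; apply: lin_sum => q.
  by apply: lin_scalel; apply: (lin_bill _ sb); exact: lin_id.
by apply: lin_scaler; apply: lin_mull; exact: lin_id.
Qed.

Lemma twmulMr x y c :
  twmul c (x * y) = \sum_(p <- cop x) \sum_(q <- cop y) \sum_(r <- cop c)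
     s r.1 (p.1 * q.1) *: (r.2 * (p.2 * q.2)).
Proof.
rewrite twmulE2.
apply: (cop_mul_sum (b := fun u v => \sum_(r <- cop c) s r.1 u *: (r.2 * v))).
split=> v; apply: lin_sum => q.
  by apply: lin_scalel; apply: (lin_bilr _ sb); exact: lin_id.
by apply: lin_scaler; apply: lin_mulr; exact: lin_id.
Qed.

Ltac lin := repeat first
  [ exact: lin_id | exact: sb | apply: lin_sum => ? | apply: (lin_bill _ sb)
  | apply: (lin_bilr _ sb) | apply: lin_mull | apply: lin_mulr
  | apply: lin_scaler | apply: lin_scalel ].

Lemma twmul_linl (X : lmodType k) (f : H -> X) a b : linear f ->
  f (twmul a b) = \sum_(p <- cop a) \sum_(q <- cop b) s p.1 q.1 *: f (p.2 * q.2).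
Proof.
move=> fl; rewrite lin_sumE //; apply: eq_bigr => p _; rewrite lin_sumE //.
by apply: eq_bigr => q _; rewrite linZE.
Qed.

Lemma coassocE (X : lmodType k) (t : H -> H -> H -> X) (a : H) : trilinear_map t ->
  \sum_(p <- cop a) \sum_(q <- cop p.1) t q.1 q.2 p.2
  = \sum_(p <- cop a) \sum_(q <- cop p.2) t p.1 q.1 q.2.
Proof. exact: cop_coassoc. Qed.

Lemma coassoc2 (X : lmodType k) (T : H -> H -> H -> H -> H -> H -> X) a b :
  (forall x y z, trilinear_map (T x y z)) ->
  (forall x y z, trilinear_map (fun u v w => T u v w x y z)) ->
  \sum_(p <- cop a) \sum_(q <- cop b)
    \sum_(u <- cop p.2) \sum_(v <- cop q.2) T p.1 u.1 u.2 q.1 v.1 v.2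
  = \sum_(p <- cop a) \sum_(q <- cop b)
    \sum_(u <- cop p.1) \sum_(v <- cop q.1) T u.1 u.2 p.2 v.1 v.2 q.2.
Proof.
move=> Tr Tl.
under eq_bigr => p _ do rewrite exchange_big /=.
under [RHS]eq_bigr => p _ do rewrite exchange_big /=.
rewrite -(coassocE (t := fun x y z => \sum_(q <- cop b) \sum_(v <- cop q.2)
   T x y z q.1 v.1 v.2)).
  apply: eq_bigr => p _; apply: eq_bigr => u _.
  by rewrite (coassocE _ (Tr _ _ _)).
by split=> x y; apply: lin_sum => q; apply: lin_sum => v;
  case: (Tl q.1 v.1 v.2).
Qed.

Lemma twmulA : associative twmul.
Proof.
move=> a b c; symmetry.
rewrite (twmul_linl _ _ (twmul_bilinear.1 c)) (twmul_linl _ _ (twmul_bilinear.2 a)).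
transitivity (\sum_(p <- cop a) \sum_(q <- cop b)
   \sum_(u <- cop p.1) \sum_(v <- cop q.1) \sum_(r <- cop c)
      s u.1 v.1 *: (s (u.2 * v.2) r.1 *: (p.2 * q.2 * r.2))).
  pose T x y z x' y' z' : H := \sum_(r <- cop c)
      s x x' *: (s (y * y') r.1 *: (z * z' * r.2)).
  rewrite -(@coassoc2 _ T).
  - do 2![apply: eq_bigr => ? _]; rewrite twmulMl scaler_sumr.
    do 2![apply: eq_bigr => ? _; rewrite ?scaler_sumr].
    by apply: eq_bigr => ? _.
  - by move=> x y z; split=> *; lin.
  - by move=> x y z; split=> *; lin.
transitivity (\sum_(p <- cop b) \sum_(q <- cop c)
   \sum_(u <- cop p.1) \sum_(v <- cop q.1) \sum_(r <- cop a)
      s u.1 v.1 *: (s r.1 (u.2 * v.2) *: (r.2 * (p.2 * q.2)))); last first.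
  pose T x y z x' y' z' : H := \sum_(r <- cop a)
      s x x' *: (s r.1 (y * y') *: (r.2 * (z * z'))).
  rewrite -(@coassoc2 _ T).
  - do 2![apply: eq_bigr => ? _]; rewrite twmulMr scaler_sumr.
    do 2![apply: eq_bigr => ? _; rewrite ?scaler_sumr].
    by apply: eq_bigr => ? _.
  - by move=> x y z; split=> *; lin.
  - by move=> x y z; split=> *; lin.
transitivity (\sum_(p <- cop a) \sum_(q <- cop b) \sum_(r <- cop c)
  (\sum_(u <- cop p.1) \sum_(v <- cop q.1) s u.1 v.1 * s (u.2 * v.2) r.1)
     *: (p.2 * q.2 * r.2)).
  do 2![apply: eq_bigr => ? _].
  under eq_bigr => u _ do rewrite exchange_big /=.
  rewrite exchange_big /=; apply: eq_bigr => r _; rewrite scaler_suml.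
  apply: eq_bigr => u _; rewrite scaler_suml.
  by apply: eq_bigr => v _; rewrite scalerA.
rewrite exchange_big /=; apply: eq_bigr => q _.
rewrite exchange_big /=; apply: eq_bigr => r _.
under [RHS]eq_bigr => u _ do rewrite exchange_big /=.
rewrite [RHS]exchange_big /=; apply: eq_bigr => p _.
rewrite (hc_assoc hs) scaler_suml; apply: eq_bigr => u _; rewrite scaler_suml.
by apply: eq_bigr => v _; rewrite scalerA mulrA.
Qed.

Lemma twmul1x : left_id 1 twmul.
Proof.
move=> a; rewrite /twmul.
rewrite (cop1 (b := fun u v => \sum_(q <- cop a) s u q.1 *: (v * q.2))).
  rewrite big_seq1 -[RHS]cop_counitl; apply: eq_bigr => p _ /=.
  by rewrite (hc_1l hs) mul1r.
by split=> v; lin.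
Qed.

Lemma twmulx1 : right_id 1 twmul.
Proof.
move=> a; rewrite twmulE2.
rewrite (cop1 (b := fun u v => \sum_(p <- cop a) s p.1 u *: (p.2 * v))).
  rewrite big_seq1 -[RHS]cop_counitl; apply: eq_bigr => p _ /=.
  by rewrite (hc_1r hs) mulr1.
by split=> v; lin.
Qed.

Lemma cop_twmul (X : lmodType k) (b : H -> H -> X) x y : bilinear_map b ->
  \sum_(u <- cop (twmul x y)) b u.1 u.2
  = \sum_(p <- cop x) \sum_(q <- cop y) b (twmul p.1 q.1) (p.2 * q.2).
Proof.
move=> bl.
rewrite (twmul_linl (f := fun z => \sum_(u <- cop z) b u.1 u.2)); last first.
  by apply: lin_D => //; exact: cop_linear.
pose T x y z x' y' z' : X := s x x' *: b (y * y') (z * z').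
have := @coassoc2 _ T x y; rewrite /T => E.
transitivity (\sum_(p <- cop x) \sum_(q <- cop y)
    \sum_(u <- cop p.2) \sum_(v <- cop q.2)
      s p.1 q.1 *: b (u.1 * v.1) (u.2 * v.2)).
  do 2![apply: eq_bigr => ? _]; rewrite (cop_mul_sum _ _ bl) scaler_sumr.
  by apply: eq_bigr => ? _; rewrite scaler_sumr.
rewrite E.
- do 2![apply: eq_bigr => ? _].
  by rewrite (twmul_linl _ _ (bl.1 _)).
- by move=> *; split=> *; lin; first [apply: (lin_bill _ bl) | apply: (lin_bilr _ bl)]; lin.
- by move=> *; split=> *; lin; first [apply: (lin_bill _ bl) | apply: (lin_bilr _ bl)]; lin.
Qed.

End Twist.

Section TwistAlg.
Variables (H : hopfAlg) (s : H -> H -> k) (hs : hopf_cocycle s).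
Notation T := (twisted hs).

HB.instance Definition _ := GRing.Lmodule.copy T H.

HB.instance Definition _ := GRing.Zmodule_isNzRing.Build T
  (twmulA hs) (twmul1x hs) (twmulx1 hs)
  (fun a b c => etrans (congr1 (fun d => twmul s (d + b) c) (esym (scale1r a)))
     (etrans (twmulDl hs 1 a b c) (congr1 (fun d => d + _) (scale1r _))))
  (fun a b c => etrans (congr1 (fun d => twmul s a (d + c)) (esym (scale1r b)))
     (etrans (twmulDr hs 1 a b c) (congr1 (fun d => d + _) (scale1r _))))
  (oner_neq0 H).
Lemma twZl (c : k) (x y : H) : c *: twmul s x y = twmul s (c *: x) y.
Proof. exact: esym (linZE c x ((twmul_bilinear hs).1 y)). Qed.
HB.instance Definition _ := GRing.Lmodule_isLalgebra.Build k T twZl.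
Lemma twZr (c : k) (x y : H) : c *: twmul s x y = twmul s x (c *: y).
Proof. exact: esym (linZE c y ((twmul_bilinear hs).2 x)). Qed.
HB.instance Definition _ := GRing.Lalgebra_isAlgebra.Build k T twZr.

Definition twisted_coact (a : T) : seq (T * H) := cop (a : H).

Lemma twisted_coactM (a b : T) :
  twisted_coact (a * b) =t tmul (twisted_coact a) (twisted_coact b).
Proof.
by move=> X f fb; rewrite big_allpairs_dep; exact: (cop_twmul hs a b fb).
Qed.

Definition cotwist : comodAlg H :=
  @ComodAlg H T twisted_coact (@cop_linear H) twisted_coactM (@cop1 H)
    (@cop_coassoc H) (@cop_counitr H).

End TwistAlg.
End Hopf.

Section MapAlg.
Variables (k : fieldType) (G : finGroupType) (A : algType k).

(* Maps G -> A with pointwise operations; the group G serves as a nonempty     *)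
(* finite domain.                                                              *)
Definition mapAlg : Type := {ffun G -> A}.
HB.instance Definition _ := GRing.Lmodule.copy mapAlg {ffun G -> A}.
Implicit Types f : mapAlg.

Definition map1 : mapAlg := [ffun => 1].
Definition map_mul f f' : mapAlg := [ffun x => f x * f' x].
Fact map_mulA : associative map_mul.
Proof. by move=> f1 f2 f3; apply/ffunP=> x; rewrite !ffunE mulrA. Qed.
Fact map_mul1l : left_id map1 map_mul.
Proof. by move=> f; apply/ffunP=> x; rewrite !ffunE mul1r. Qed.
Fact map_mul1r : right_id map1 map_mul.
Proof. by move=> f; apply/ffunP=> x; rewrite !ffunE mulr1. Qed.
Fact map_mulDl : left_distributive map_mul +%R.
Proof. by move=> f1 f2 f3; apply/ffunP=> x; rewrite !ffunE mulrDl. Qed.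
Fact map_mulDr : right_distributive map_mul +%R.
Proof. by move=> f1 f2 f3; apply/ffunP=> x; rewrite !ffunE mulrDr. Qed.
Fact map1_neq0 : map1 != 0.
Proof. by apply/eqP => /ffunP/(_ 1%g)/eqP; rewrite !ffunE oner_eq0. Qed.
HB.instance Definition _ := GRing.Zmodule_isNzRing.Build mapAlg
  map_mulA map_mul1l map_mul1r map_mulDl map_mulDr map1_neq0.
Fact map_scaleAl (c : k) f f' : c *: map_mul f f' = map_mul (c *: f) f'.
Proof. by apply/ffunP=> x; rewrite !ffunE scalerAl. Qed.
HB.instance Definition _ :=
  GRing.Lmodule_isLalgebra.Build k mapAlg map_scaleAl.
Fact map_scaleAr (c : k) f f' : c *: map_mul f f' = map_mul f (c *: f').
Proof. by apply/ffunP=> x; rewrite !ffunE scalerAr. Qed.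
HB.instance Definition _ :=
  GRing.Lalgebra_isAlgebra.Build k mapAlg map_scaleAr.

End MapAlg.

Section FunHopf.
Variables (k : fieldType) (G : finGroupType).
Notation kG := (mapAlg G k^o).
Implicit Types f : kG.

Definition dual_basis (g : G) : kG := [ffun x => (x == g)%:R].

Definition kG_cop f : seq (kG * kG) :=
  [seq (dual_basis h, [ffun x => f (h * x)%g] : kG) | h : G].
Definition kG_counit f : k := f 1%g.
Definition kG_antipode f : kG := [ffun x => f x^-1%g].

Lemma kG_cop_sum (X : zmodType) (F : kG * kG -> X) f :
  \sum_(p <- kG_cop f) F p
  = \sum_(h : G) F (dual_basis h, [ffun x => f (h * x)%g]).
Proof. by rewrite big_map enumT. Qed.

Lemma kG_copE f g h : \sum_(p <- kG_cop f) p.1 g * p.2 h = f (g * h)%g.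
Proof.
rewrite kG_cop_sum (bigD1 g) //= !ffunE eqxx mul1r.
rewrite big1 ?addr0 // => i /negPf ig; by rewrite !ffunE eq_sym ig mul0r.
Qed.

Lemma sum_delta (V : lmodType k) (F : G -> V) (x : G) :
  \sum_(h : G) (x == h)%:R *: F h = F x.
Proof.
rewrite (bigD1 x) //= eqxx scale1r big1 ?addr0 // => i /negPf ix.
by rewrite eq_sym ix scale0r.
Qed.

Lemma sum_dual_basis : \sum_(h : G) dual_basis h = 1.
Proof.
apply/ffunP=> x; rewrite sum_ffunE [RHS]ffunE.
under eq_bigr do rewrite ffunE -[_%:R]mulr1.
exact: (sum_delta (fun _ => 1 : k^o)).
Qed.

Lemma sum_dual_basisE f : \sum_(h : G) f h *: dual_basis h = f.
Proof.
apply/ffunP=> x; rewrite sum_ffunE.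
under eq_bigr do rewrite !ffunE [_ *: _]mulrC.
exact: (sum_delta f).
Qed.

Lemma dual_basisM g h : dual_basis g * dual_basis h = (g == h)%:R *: dual_basis g.
Proof.
apply/ffunP=> x; rewrite !ffunE -[_ *: _]/(_ * _) -!natrM !mulnb.
by case: (x =P g) => [->|]; rewrite ?andbT ?andbF.
Qed.

Lemma dual_basis_shift g h :
  [ffun x => dual_basis g (h * x)%g] = dual_basis (h^-1 * g)%g :> kG.
Proof.
by apply/ffunP=> x; rewrite !ffunE -(can2_eq (mulKg h) (mulKVg h)).
Qed.

Lemma kG_cop_linear : tlinear kG_cop.
Proof.
move=> c x y X b bl; rewrite big_cat [X in _ = X + _]big_map /= !kG_cop_sum.
rewrite -big_split /=; apply: eq_bigr => h _.
rewrite (linZE _ _ (bl.1 _)) -(bl.2 _); congr (b _ _).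
by apply/ffunP=> z; rewrite !ffunE.
Qed.

Lemma kG_copM f f' : kG_cop (f * f') =t tmul (kG_cop f) (kG_cop f').
Proof.
move=> X b bl; rewrite big_allpairs_dep !kG_cop_sum; apply: eq_bigr => h _ /=.
rewrite kG_cop_sum -[LHS](sum_delta (fun l => b (dual_basis h) [ffun x => (f * f') (l * x)%g])).
apply: eq_bigr => l _ /=; rewrite dual_basisM (linZE _ _ (bl.1 _)).
case: eqP => [->|_]; last by rewrite !scale0r.
by congr (_ *: b _ _); apply/ffunP=> z; rewrite !ffunE.
Qed.

Lemma kG_cop1 : kG_cop 1 =t [:: (1, 1)].
Proof.
move=> X b bl; rewrite big_seq1 kG_cop_sum /= -sum_dual_basis.
rewrite (lin_sumE _ _ (bl.1 _)) sum_dual_basis.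
by apply: eq_bigr => h _; congr (b _ _); apply/ffunP=> z; rewrite !ffunE.
Qed.

Lemma kG_counit_linear : linear (kG_counit : kG -> k^o).
Proof. by move=> c x y; rewrite /kG_counit !ffunE. Qed.

Lemma kG_counitM f f' : kG_counit (f * f') = kG_counit f * kG_counit f'.
Proof. by rewrite /kG_counit !ffunE. Qed.

Lemma kG_counit1 : kG_counit 1 = 1.
Proof. by rewrite /kG_counit !ffunE. Qed.

Lemma kG_antipode_linear : linear kG_antipode.
Proof. by move=> c x y; apply/ffunP=> z; rewrite !ffunE. Qed.

Lemma kG_coassoc : coassociative kG_cop kG_cop.
Proof.
move=> f X t tl; rewrite !kG_cop_sum /=.
under eq_bigr => h _ do rewrite kG_cop_sum /=.
under [RHS]eq_bigr => h _ do rewrite kG_cop_sum /=.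
rewrite exchange_big /=; apply: eq_bigr => l _.
rewrite (reindex_inj (mulgI l)) /=; apply: eq_bigr => h _.
rewrite dual_basis_shift mulKg; congr (t _ _ _).
by apply/ffunP=> z; rewrite !ffunE mulgA.
Qed.

Lemma kG_counitl f : \sum_(p <- kG_cop f) kG_counit p.1 *: p.2 = f.
Proof.
rewrite kG_cop_sum /=; apply/ffunP=> z; rewrite sum_ffunE.
under eq_bigr => h _ do rewrite /kG_counit !ffunE.
by have := sum_delta (fun h => f (h * z)%g) 1%g; rewrite mul1g.
Qed.

Lemma kG_counitr f : \sum_(p <- kG_cop f) kG_counit p.2 *: p.1 = f.
Proof.
rewrite kG_cop_sum /= -[RHS]sum_dual_basisE; apply: eq_bigr => h _.
by rewrite /kG_counit ffunE mulg1.
Qed.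

Lemma kG_antipodel f :
  \sum_(p <- kG_cop f) kG_antipode p.1 * p.2 = kG_counit f *: 1.
Proof.
rewrite kG_cop_sum /=; apply/ffunP=> z; rewrite sum_ffunE.
under eq_bigr => h _ do rewrite !ffunE.
rewrite !ffunE [RHS]mulr1 /kG_counit -(mulVg z).
exact: (sum_delta (fun h => f (h * z)%g)).
Qed.

Lemma kG_antipoder f :
  \sum_(p <- kG_cop f) p.1 * kG_antipode p.2 = kG_counit f *: 1.
Proof.
rewrite kG_cop_sum /=; apply/ffunP=> z; rewrite sum_ffunE.
under eq_bigr => h _ do rewrite !ffunE.
rewrite !ffunE [RHS]mulr1 /kG_counit -(mulgV z).
exact: (sum_delta (fun h => f (h * z^-1)%g)).
Qed.

(* The Hopf algebra k^G; kG_copE is its defining identity f_1(g)f_2(h) = f(gh) *)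
Definition funHopf : hopfAlg k :=
  HopfAlg kG_cop_linear kG_copM kG_cop1 kG_counit_linear kG_counitM kG_counit1
    kG_antipode_linear kG_coassoc kG_counitl kG_counitr kG_antipodel kG_antipoder.

End FunHopf.

Section TwistedGroupAlgebra.
Variables (k : fieldType) (A : finGroupType).

Record cocycle2 := Cocycle2 {
  eta :> A -> A -> k;
  eta_neq0 : forall g h, eta g h != 0;
  eta1g : forall g, eta 1%g g = 1;
  etag1 : forall g, eta g 1%g = 1;
  etaA : forall g h l, eta g h * eta (g * h)%g l = eta h l * eta g (h * l)%g
}.

(* The map x stands for the element \sum_g x(g) g of k_eta A.                  *)
Definition twGroupAlg (e : cocycle2) : Type := {ffun A -> k^o}.

Variable e : cocycle2.
HB.instance Definition _ := GRing.Lmodule.copy (twGroupAlg e) {ffun A -> k^o}.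
Implicit Types x y z : twGroupAlg e.

Definition tg_basis (g : A) : twGroupAlg e := [ffun h => (h == g)%:R].

Definition tg_mul x y : twGroupAlg e :=
  [ffun u => \sum_(g : A) e g (g^-1 * u)%g * x g * y (g^-1 * u)%g].

Fact tg_mulA : associative tg_mul.
Proof.
move=> x y z; apply/ffunP=> u; rewrite !ffunE.
under eq_bigr => g _ do rewrite ffunE mulr_sumr.
under [RHS]eq_bigr => g _ do rewrite ffunE mulr_sumr mulr_suml.
rewrite [RHS]exchange_big /=; apply: eq_bigr => l _.
rewrite [RHS](reindex_inj (mulgI l)) /=; apply: eq_bigr => m _.
rewrite mulKg invMg mulgA; set c := (_ * _ * u)%g.
have -> : (l^-1 * u = m * c)%g by rewrite /c -!mulgA mulKVg.
transitivity (e m c * e l (m * c)%g * (x l * (y m * z c))).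
  by rewrite -[_ * y m * z c]mulrA mulrACA; congr (_ * _); exact: mulrC.
by rewrite -etaA -!mulrA mulrCA.
Qed.

Lemma sum_pick (F : A -> k) g : \sum_(h : A) (h == g)%:R * F h = F g.
Proof.
rewrite (bigD1 g) //= eqxx mul1r big1 ?addr0 // => i /negPf ->.
by rewrite mul0r.
Qed.

Fact tg_mul1l : left_id (tg_basis 1%g) tg_mul.
Proof.
move=> x; apply/ffunP=> u; rewrite !ffunE.
under eq_bigr => g _ do rewrite ffunE mulrAC mulrC.
by rewrite sum_pick invg1 mul1g eta1g mul1r.
Qed.

Fact tg_mul1r : right_id (tg_basis 1%g) tg_mul.
Proof.
move=> x; apply/ffunP=> u; rewrite !ffunE.
under eq_bigr => g _ do
  rewrite ffunE -(inj_eq (mulgI g)) mulKVg mulg1 eq_sym mulrC.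
by rewrite sum_pick mulVg etag1 mul1r.
Qed.

Fact tg_mulDl : left_distributive tg_mul +%R.
Proof.
move=> x y z; apply/ffunP=> u; rewrite !ffunE -big_split /=.
by apply: eq_bigr => g _; rewrite !ffunE mulrDr mulrDl.
Qed.

Fact tg_mulDr : right_distributive tg_mul +%R.
Proof.
move=> x y z; apply/ffunP=> u; rewrite !ffunE -big_split /=.
by apply: eq_bigr => g _; rewrite !ffunE mulrDr.
Qed.

Fact tg_1neq0 : tg_basis 1%g != 0.
Proof. by apply/eqP => /ffunP/(_ 1%g)/eqP; rewrite !ffunE eqxx oner_eq0. Qed.

HB.instance Definition _ := GRing.Zmodule_isNzRing.Build (twGroupAlg e)
  tg_mulA tg_mul1l tg_mul1r tg_mulDl tg_mulDr tg_1neq0.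

Fact tg_scaleAl (c : k) x y : c *: tg_mul x y = tg_mul (c *: x) y.
Proof.
apply/ffunP=> u; rewrite !ffunE scaler_sumr.
apply: eq_bigr => g _; rewrite !ffunE.
by rewrite -[LHS]/(_ * _) -[c *: x g]/(c * x g) !mulrA [c * _]mulrC.
Qed.
HB.instance Definition _ :=
  GRing.Lmodule_isLalgebra.Build k (twGroupAlg e) tg_scaleAl.

Fact tg_scaleAr (c : k) x y : c *: tg_mul x y = tg_mul x (c *: y).
Proof.
apply/ffunP=> u; rewrite !ffunE scaler_sumr.
apply: eq_bigr => g _; rewrite !ffunE.
by rewrite -[LHS]/(_ * _) -[c *: y _]/(c * y _) mulrCA.
Qed.
HB.instance Definition _ :=
  GRing.Lalgebra_isAlgebra.Build k (twGroupAlg e) tg_scaleAr.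

Lemma tg_basisM g h : tg_basis g * tg_basis h = e g h *: tg_basis (g * h)%g.
Proof.
apply/ffunP=> u; rewrite !ffunE.
under eq_bigr => l _ do rewrite !ffunE mulrAC mulrC.
rewrite sum_pick -(inj_eq (mulgI g)) mulKVg.
by rewrite -[RHS]/(_ * _); case: eqP => [->|_]; rewrite ?mulKg ?mulr0.
Qed.

Definition tg_basisV (g : A) : twGroupAlg e :=
  (e g g^-1%g)^-1 *: tg_basis g^-1%g.

Lemma tg_basis_mulV g : tg_basis g * tg_basisV g = 1.
Proof.
by rewrite -scalerAr tg_basisM scalerA mulVf ?eta_neq0 // scale1r mulgV.
Qed.

Lemma tg_basis_Vmul g : tg_basisV g * tg_basis g = 1.
Proof.
have E : e g g^-1%g = e g^-1%g g.
  by have := etaA e g g^-1%g g; rewrite mulgV mulVg eta1g etag1 !mulr1.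
by rewrite -scalerAl tg_basisM scalerA E mulVf ?eta_neq0 // scale1r mulVg.
Qed.

(* s.x, conjugation by the basis element s, whose inverse is tg_basisV s.       *)
Definition tg_act (s : A) x : twGroupAlg e := tg_basis s * x * tg_basisV s.

Lemma tg_act1 s : tg_act s 1 = 1.
Proof. by rewrite /tg_act mulr1 tg_basis_mulV. Qed.

Lemma tg_act_linear s : linear (tg_act s).
Proof.
by move=> c x y; rewrite /tg_act mulrDr mulrDl scalerAl scalerAr.
Qed.

Lemma tg_actM s x y : tg_act s (x * y) = tg_act s x * tg_act s y.
Proof.
by rewrite /tg_act !mulrA -[_ * tg_basis s]mulrA tg_basis_Vmul mulr1.
Qed.

Definition eta_form (g h : A) : k := e g h * (e h g)^-1.

(* <-,-> is a non-degenerate bimultiplicative symplectic (i.e. alternating)    *)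
(* form; only the last condition has content when A is abelian.                *)
Definition nondegenerate_cocycle : Prop :=
  [/\ forall g g' h, eta_form (g * g')%g h = eta_form g h * eta_form g' h,
      forall g h h', eta_form g (h * h')%g = eta_form g h * eta_form g h',
      forall g, eta_form g g = 1
    & forall g, (forall h, eta_form g h = 1) -> g = 1%g].

End TwistedGroupAlgebra.

Section InducedAlgebra.
Variables (k : fieldType) (gT : finGroupType) (S : {group gT}).
Variable e : cocycle2 k (subg_of S).

Definition ind_pred : {pred mapAlg gT (twGroupAlg e)} :=
  fun r => [forall s : subg_of S, [forall g : gT,
    r (sgval s * g)%g == tg_act s (r g)]].

Lemma ind_predP (r : mapAlg gT (twGroupAlg e)) :
  reflect (forall s g, r (sgval s * g)%g = tg_act s (r g)) (r \in ind_pred).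
Proof.
apply: (iffP forallP) => h s; first by move=> g; apply/eqP/(forallP (h s)).
by apply/forallP => g; apply/eqP.
Qed.

Fact ind_subalg_closed : subalg_closed ind_pred.
Proof.
split.
- by apply/ind_predP => s g; rewrite !ffunE tg_act1.
- move=> c r r' /ind_predP h /ind_predP h'; apply/ind_predP => s g.
  by rewrite !ffunE h h' tg_act_linear.
- move=> r r' /ind_predP h /ind_predP h'; apply/ind_predP => s g.
  by rewrite !ffunE h h' tg_actM.
Qed.
HB.instance Definition _ := GRing.isSubalgClosed.Build k
  (mapAlg gT (twGroupAlg e)) ind_pred ind_subalg_closed.

(* R(S, eta); normality of S in G plays no role in its definition.             *)
Record indAlg : predArgType := IndAlg {
  ind_val : mapAlg gT (twGroupAlg e);
  ind_valP : ind_val \in ind_pred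
}.
HB.instance Definition _ := [isSub for ind_val].
HB.instance Definition _ := [Choice of indAlg by <:].
HB.instance Definition _ := [SubChoice_isSubAlgebra of indAlg by <:].

Fact ind_move_subproof (g : gT) (r : indAlg) :
  ([ffun h => ind_val r (h * g)%g] : mapAlg gT (twGroupAlg e)) \in ind_pred.
Proof.
apply/ind_predP => s h; rewrite !ffunE -mulgA.
exact: (ind_predP _ (ind_valP r)).
Qed.

Definition ind_move (g : gT) (r : indAlg) : indAlg :=
  IndAlg (ind_move_subproof g r).

Lemma ind_moveE g r h : ind_val (ind_move g r) h = ind_val r (h * g)%g.
Proof. by rewrite ffunE. Qed.

Lemma ind_eq (r r' : indAlg) : ind_val r =1 ind_val r' -> r = r'.
Proof. by move=> h; apply/val_inj/ffunP. Qed.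

Lemma ind_move_linear g : linear (ind_move g).
Proof. by move=> c r r'; apply: ind_eq => h; rewrite !ffunE. Qed.

Lemma ind_moveM g r r' : ind_move g (r * r') = ind_move g r * ind_move g r'.
Proof. by apply: ind_eq => h; rewrite !ffunE. Qed.

Lemma ind_move1 g : ind_move g 1 = 1.
Proof. by apply: ind_eq => h; rewrite !ffunE. Qed.

Notation kG := (funHopf k gT).

(* The coaction r |-> \sum_g e_g (x) g.r, with the factors in the order of a    *)
(* right coaction: it satisfies the coassociativity of a right comodule for the *)
(* left action (g.r)(h) = r(hg).                                               *)
Definition ind_coact (r : indAlg) : seq (indAlg * kG) :=
  [seq (ind_move g r, dual_basis k g : kG) | g : gT].

Lemma ind_coact_sum (X : zmodType) (F : indAlg * kG -> X) r :
  \sum_(p <- ind_coact r) F p = \sum_(g : gT) F (ind_move g r, dual_basis k g).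
Proof. by rewrite big_map enumT. Qed.

Lemma ind_coact_linear : tlinear ind_coact.
Proof.
move=> c x y X b bl; rewrite big_cat [X in _ = X + _]big_map /= !ind_coact_sum.
rewrite -big_split /=; apply: eq_bigr => h _.
by rewrite ind_move_linear (bl.1 _) (linZE _ _ (bl.1 _)).
Qed.

Lemma ind_coactM r r' : ind_coact (r * r') =t tmul (ind_coact r) (ind_coact r').
Proof.
move=> X b bl; rewrite big_allpairs_dep !ind_coact_sum.
apply: eq_bigr => g _ /=; rewrite ind_coact_sum /=.
rewrite -[LHS](sum_delta (fun h => b (ind_move h (r * r')) (dual_basis k h))).
apply: eq_bigr => h _ /=; rewrite dual_basisM (linZE _ _ (bl.2 _)) ind_moveM.
by case: eqP => [->|_] //; rewrite !scale0r.
Qed.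

Lemma ind_coact1 : ind_coact 1 =t [:: (1, 1)].
Proof.
move=> X b bl; rewrite big_seq1 ind_coact_sum /= -[in RHS](sum_dual_basis k gT).
rewrite (lin_sumE _ _ (bl.2 _)).
by apply: eq_bigr => h _; rewrite ind_move1.
Qed.

Lemma ind_coassoc : coassociative (@cop k kG) ind_coact.
Proof.
move=> r X t tl; rewrite !ind_coact_sum /=.
under eq_bigr => g _ do rewrite ind_coact_sum /=.
under [RHS]eq_bigr => g _ do rewrite kG_cop_sum /=.
rewrite exchange_big [RHS]exchange_big /=; apply: eq_bigr => h _.
rewrite [RHS](reindex_inj (mulgI h)) /=; apply: eq_bigr => g _.
rewrite dual_basis_shift mulKg; congr (t _ _ _).
by apply: ind_eq => l; rewrite !ffunE mulgA.
Qed.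

Lemma ind_counit r : \sum_(p <- ind_coact r) counit p.2 *: p.1 = r.
Proof.
rewrite ind_coact_sum /=.
under eq_bigr => g _ do rewrite /kG_counit ffunE.
rewrite (sum_delta (fun g => ind_move g r)).
by apply: ind_eq => h; rewrite ffunE mulg1.
Qed.

Definition indComod : comodAlg kG :=
  ComodAlg ind_coact_linear ind_coactM ind_coact1 ind_coassoc ind_counit.

Definition alpha (f f' : kG) : k :=
  (#|S|%:R ^+ 2)^-1 *
  \sum_(r : subg_of S) \sum_(t : subg_of S)
  \sum_(r' : subg_of S) \sum_(t' : subg_of S)
    e t t' * eta_form e t r * eta_form e t' r'
    * f (sgval r) * f' (sgval r').

End InducedAlgebra.

(* Main.v *)
(* For t in S let E_t = |S|^-1 \sum_r <t,r> r in k[S].  As <-,-> is            *)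
(* non-degenerate these are the primitive idempotents of k[S], and             *)
(* alpha = \sum_(t,t') eta(t,t') E_t (x) E_t' in the dual of k^G (x) k^G.      *)
(* Hence convolution of such forms is pointwise multiplication of the          *)
(* coefficients eta(t,t'), and the Hopf cocycle condition on alpha becomes the *)
(* cocycle condition on eta.  Translating f by E_t projects it onto its        *)
(* component f_t of S-weight t, i.e. f_t(sg) = <s,t> f_t(g), and               *)
(* f |-> (g |-> \sum_t f_t(g) t) is the isomorphism: s acts on t in k_eta S    *)
(* by the same scalar <s,t>, and the inverse sums the coordinates of r(g).     *)
Require Import Defs.
From HB Require Import structures.
From mathcomp Require Import all_boot all_order all_algebra all_fingroup.
From mathcomp Require Import ring.
Set Implicit Arguments.
Unset Strict Implicit.
Unset Printing Implicit Defensive.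
Import GRing.Theory.
Local Open Scope ring_scope.

(** Everything rests on diagonalizing left translation by [S] on functions. Non-degeneracy gives
    character orthogonality ([sum_eta_form]), hence f is the sum of its components f_t
    ([sum_weight_comp]), and these are determined by their weights ([weight_comp_weight]). A
    Sweedler sum with a weight form on the first legs becomes a double sum over weights of the
    second legs ([sum_cop_weight_form]). Since [alpha] is the weight form with coefficients eta
    ([alphaE]), this yields both the cocycle identity and the product f . f' = sum of eta(t,t') f_t
    f'_t', which matches t . t' = eta(t,t') tt' in k_eta S ([weight_val_twmul]). Conjugation in
    k_eta S is diagonal with the same characters ([tg_act_coord]), so R(S, eta) consists exactly of
    the families of components; right translation commutes with the decomposition, whence
    colinearity. *)

Lemma comodAlg_isoI (k : fieldType) (H : hopfAlg k) (A B : comodAlg H)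
    (f : A -> B) :
    linear f -> f 1 = 1 -> {morph f : x y / x * y} -> bijective f ->
    (forall a, tmap f id (coact a) =t coact (f a)) ->
  comodAlg_iso A B.
Proof.
move=> fl f1 fM bij_f f_coact.
pose linf := GRing.isLinear.Build k A B *:%R f fl.
pose monf := GRing.isMonoidMorphism.Build A B f (f1, fM).
pose phi : {lrmorphism A -> B} := HB.pack f linf monf.
by exists phi.
Qed.

(** Transports the cocycle property along pointwise equality, without function extensionality. *)
Lemma eq_hopf_cocycle (k : fieldType) (H : hopfAlg k) (s t : H -> H -> k) :
  s =2 t -> hopf_cocycle s -> hopf_cocycle t.
Proof.
move=> st [[sl sr] [v vl svE] s1l s1r sA]; split.
- by split=> x c y z; rewrite -!st; [apply: sl | apply: sr].
- exists v => // a b; have [sv vs] := svE a b.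
  by split; [rewrite -sv | rewrite -vs]; do 2![apply: eq_bigr => ? _]; rewrite st.
- by move=> a; rewrite -st.
- by move=> a; rewrite -st.
- move=> a b c; have := sA a b c.
  under eq_bigr do under eq_bigr do rewrite !st.
  by under [X in _ = X -> _]eq_bigr do under eq_bigr do rewrite !st.
Qed.

(** Both sides expand to the sum of f(hg) B(e_h, e_g). The right-hand form has the shape of the
    coaction on R(S, eta). *)
Lemma kG_cop_right_translate (k : fieldType) (G : finGroupType)
    (X : lmodType k) (B : mapAlg G k^o -> mapAlg G k^o -> X) f : bilinear_map B ->
  \sum_(p <- kG_cop f) B p.1 p.2
  = \sum_(g : G) B [ffun h => f (h * g)%g] (dual_basis k g).
Proof.
move=> [Bl Br]; rewrite kG_cop_sum /=.
under eq_bigr => h _ do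
  rewrite -[X in B _ X]sum_dual_basisE (lin_sumE _ _ (Br _)).
rewrite exchange_big; apply: eq_bigr => g _ /=.
rewrite -[X in _ = B X _]sum_dual_basisE (lin_sumE _ _ (Bl _)).
by apply: eq_bigr => h _; rewrite (linZE _ _ (Br _)) (linZE _ _ (Bl _)) !ffunE.
Qed.

(** * Orthogonality for the commutator form, and conjugation in k_eta A *)

Section EtaForm.
Variables (k : fieldType) (A : finGroupType) (e : cocycle2 k A).
Hypothesis nd : nondegenerate_cocycle e.
Local Notation form := (eta_form e).

Lemma eta_formMl g g' h : form (g * g')%g h = form g h * form g' h.
Proof. by case: nd. Qed.

Lemma eta_formMr g h h' : form g (h * h')%g = form g h * form g h'.
Proof. by case: nd. Qed.

Lemma eta_formV g h : (form g h)^-1 = form h g.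
Proof. by rewrite /eta_form invfM invrK mulrC. Qed.

Lemma eta_form_neq0 g h : form g h != 0.
Proof. by rewrite mulf_neq0 ?invr_eq0 ?eta_neq0. Qed.

Lemma eta_form1g h : form 1%g h = 1.
Proof. by rewrite /eta_form eta1g etag1 invr1 mulr1. Qed.

Lemma eta_formVg g h : form g^-1%g h = form h g.
Proof.
apply: (mulfI (eta_form_neq0 g h)).
by rewrite -eta_formMl mulgV eta_form1g -[form h g]eta_formV mulfV ?eta_form_neq0.
Qed.

Lemma sum_eta_form g : \sum_(h : A) form g h = #|A|%:R * (g == 1%g)%:R.
Proof.
have [->|g_neq1] := eqVneq g 1%g.
  by under eq_bigr do rewrite eta_form1g; rewrite sumr_const mulr1.
have [h gh_neq1] : exists h, form g h != 1.
  apply/existsP; apply: contraNT g_neq1 => /existsPn gE; apply/eqP.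
  by case: nd => _ _ _; apply=> h; apply/eqP; rewrite -[_ == _]negbK gE.
rewrite mulr0; apply/eqP; have := gh_neq1; rewrite -subr_eq0 => /negPf gh.
(* Translating the summation variable by [h] multiplies the sum by <g,h>, which differs from 1, so
   the sum vanishes. *)
rewrite -[_ == 0]orFb -gh -mulf_eq0 mulrBl mul1r subr_eq0 mulr_sumr.
rewrite [X in _ == X](reindex_inj (mulgI h)) /=.
by apply/eqP/eq_bigr => l _; rewrite eta_formMr.
Qed.

Lemma sum_eta_form_orth g l :
  \sum_(h : A) form g h * form h l = #|A|%:R * (g == l)%:R.
Proof.
rewrite -(inj_eq (mulIg l^-1%g)) mulgV -sum_eta_form.
by apply: eq_bigr => h _; rewrite eta_formMl eta_formVg.
Qed.

Hypothesis abA : forall g h : A, (g * h = h * g)%g.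

(** In the commutative group, g . h and h . g are both multiples of gh, with ratio <g,h>. *)
Lemma tg_act_coord g (x : twGroupAlg e) h : tg_act g x h = form g h * x h.
Proof.
pose y : twGroupAlg e := [ffun l => form g l * x l].
suff E : y * tg_basis e g = tg_basis e g * x.
  by rewrite /tg_act -E -mulrA tg_basis_mulV mulr1 ffunE.
apply/ffunP => u; rewrite !ffunE.
have lE l : (l^-1 * u == g)%g = (l == g^-1 * u)%g.
  by rewrite abA -(inj_eq (mulIg l)) mulgKV -(inj_eq (mulgI g^-1%g)) mulKg eq_sym.
rewrite (bigD1 (g^-1 * u)%g) //= [X in _ + X]big1 ?addr0; last first.
  by move=> l /negPf nl; rewrite [tg_basis _ _ _]ffunE lE nl mulr0.
rewrite [RHS](bigD1 g) //= [X in _ = _ + X]big1 ?addr0; last first.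
  by move=> l /negPf nl; rewrite [tg_basis _ _ _]ffunE nl mulr0 mul0r.
have -> : ((g^-1 * u)^-1 * u = g)%g by apply/eqP; rewrite lE.
rewrite !ffunE !eqxx !mulr1 mulrA; congr (_ * _).
by rewrite /eta_form mulrCA mulfV ?mulr1 ?eta_neq0.
Qed.

End EtaForm.

(** * Weight decomposition of k^G under left translation by [S] *)

Section WeightComponents.
Variables (k : fieldType) (gT : finGroupType) (S : {group gT}).
Variable e : cocycle2 k (subg_of S).
Hypotheses (nd : nondegenerate_cocycle e) (nz_S : #|S|%:R != 0 :> k).
Local Notation form := (eta_form e).
Local Notation kG := (mapAlg gT k^o).
Implicit Types f x y : kG.

Definition weight_comp (t : subg_of S) f : kG :=
  [ffun g => #|S|%:R^-1 * \sum_(r : subg_of S) form t r * f (sgval r * g)%g].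

Definition has_weight (t : subg_of S) f : Prop :=
  forall s g, f (sgval s * g)%g = form s t * f g.

Lemma weight_comp_linear t : linear (weight_comp t).
Proof.
have scE (a : k) (b : k^o) : a *: b = a * b by [].
move=> c x y; apply/ffunP => g; rewrite !ffunE scE mulrCA -mulrDr.
congr (_ * _); rewrite mulr_sumr -big_split /=; apply: eq_bigr => r _.
by rewrite !ffunE scE mulrDr mulrCA.
Qed.

Lemma weight_compP t f : has_weight t (weight_comp t f).
Proof.
move=> s g; rewrite !ffunE mulrCA; congr (_ * _).
rewrite mulr_sumr [RHS](reindex_inj (mulIg s)) /=; apply: eq_bigr => r _.
rewrite (eta_formMr nd) mulrA [form s t * _]mulrCA -[form s t]eta_formV.
by rewrite mulVf ?eta_form_neq0 // mulr1 mulgA.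
Qed.

Lemma has_weightM t u x y :
  has_weight t x -> has_weight u y -> has_weight (t * u)%g (x * y).
Proof.
move=> xt yu s g; rewrite !ffunE xt yu (eta_formMr nd).
exact: (mulrACA (form s t) (x g) (form s u)).
Qed.

(** On a function of weight t the average becomes the sum over r of <u,r><r,t>, so orthogonality
    applies. *)
Lemma weight_comp_weight t u x :
  has_weight t x -> weight_comp u x = (u == t)%:R *: x.
Proof.
move=> xt; apply/ffunP => g; rewrite !ffunE.
under eq_bigr do rewrite xt mulrA.
by rewrite -mulr_suml (sum_eta_form_orth nd) card_sub mulrA mulrA mulVf ?mul1r.
Qed.

Lemma sum_weight_comp f : \sum_t weight_comp t f = f.
Proof.
apply/ffunP => g; rewrite sum_ffunE.
under eq_bigr do rewrite ffunE.
rewrite -mulr_sumr exchange_big /=.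
under eq_bigr => r _.
  (* Writing <t,r> as <r^-1,t> moves the summation variable into the second slot, where
     [sum_eta_form] applies. *)
  rewrite -mulr_suml; under eq_bigr do rewrite -(eta_formVg nd).
  rewrite (sum_eta_form nd) card_sub -mulrA eq_invg1.
  over.
by rewrite -mulr_sumr mulrA mulVf // mul1r sum_pick mul1g.
Qed.

Lemma has_weight1 : has_weight 1%g 1.
Proof.
by move=> s g; rewrite !ffunE -[form s _]eta_formV eta_form1g invr1 mul1r.
Qed.

(* Summing over the Sweedler components of f applies the functional E_t to the *)
(* first one, i.e. averages the left translates of f.                          *)
Lemma sum_cop_weight_comp (X : lmodType k) (F : kG -> X) t f : linear F ->
  \sum_(p <- kG_cop f) weight_comp t p.1 1%g *: F p.2 = F (weight_comp t f).
Proof.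
move=> Fl; rewrite kG_cop_sum /=.
under eq_bigr do rewrite ffunE mulr_sumr scaler_suml.
rewrite exchange_big /=.
transitivity (\sum_(r : subg_of S) F (#|S|%:R^-1 *: (form t r *:
    ([ffun g => f (sgval r * g)%g] : kG)))).
  apply: eq_bigr => r _; rewrite !(linZE _ _ Fl) scalerA.
  rewrite -[RHS](sum_delta (fun h => (#|S|%:R^-1 * form t r) *:
    F [ffun g => f (h * g)%g])).
  apply: eq_bigr => h _; rewrite ffunE mulg1 scalerA; congr (_ *: _).
  by rewrite mulrA mulrC.
rewrite -(lin_sumE _ _ Fl); congr F; apply/ffunP => g.
rewrite sum_ffunE ffunE mulr_sumr; apply: eq_bigr => r _.
by rewrite !ffunE.
Qed.

(** * Bilinear forms diagonal in the weights, and the cocycle property *)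

(** The coefficients [c] are arbitrary so that convolution inverses and the counit form are covered
    too. *)
Definition weight_form (c : subg_of S -> subg_of S -> k) f f' : k :=
  \sum_t \sum_t' c t t' * weight_comp t f 1%g * weight_comp t' f' 1%g.

Lemma alphaE f f' : alpha e f f' = weight_form e f f'.
Proof.
rewrite /alpha /weight_form exchange_big mulr_sumr; apply: eq_bigr => t _ /=.
under eq_bigr do rewrite exchange_big.
rewrite exchange_big mulr_sumr; apply: eq_bigr => t' _ /=.
have mulE (c d x y : k) : c * (d * x) * (d * y) = d * d * (c * (x * y)) by ring.
rewrite !ffunE mulE expr2 invfM; congr (_ * _).
rewrite mulr_suml mulr_sumr; apply: eq_bigr => r _; rewrite !mulr_sumr.
by apply: eq_bigr => r' _; rewrite !mulg1; ring.
Qed.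

Lemma weight_form_bilinear c : bilinear_map (weight_form c : kG -> kG -> k^o).
Proof.
have scE (a : k) (b : k^o) : a *: b = a * b by [].
split=> z a x y; rewrite scE /weight_form mulr_sumr -big_split;
  apply: eq_bigr => t _; rewrite mulr_sumr -big_split; apply: eq_bigr => t' _;
  rewrite weight_comp_linear [X in _ = X]/=; move: (weight_comp _ z 1%g) => w;
  rewrite !ffunE scE; ring.
Qed.

(** Convolution, both sides of the cocycle identity and the twisted product are all instances, for
    different [B]. *)
Lemma sum_cop_weight_form (X : lmodType k) (B : kG -> kG -> X) c f f' :
    bilinear_map B ->
  \sum_(p <- kG_cop f) \sum_(q <- kG_cop f') weight_form c p.1 q.1 *: B p.2 q.2
  = \sum_t \sum_t' c t t' *: B (weight_comp t f) (weight_comp t' f').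
Proof.
move=> [Bl Br].
transitivity (\sum_(p <- kG_cop f) \sum_(q <- kG_cop f') \sum_t \sum_t'
    c t t' *: (weight_comp t p.1 1%g *: (weight_comp t' q.1 1%g *: B p.2 q.2))).
  do 2![apply: eq_bigr => ? _]; rewrite scaler_suml.
  do 2![apply: eq_bigr => ? _; rewrite ?scaler_suml].
  by rewrite !scalerA mulrA.
under eq_bigr do rewrite exchange_big.
rewrite exchange_big; apply: eq_bigr => t _ /=.
under eq_bigr do rewrite exchange_big.
rewrite exchange_big; apply: eq_bigr => t' _ /=.
rewrite -(sum_cop_weight_comp t f (Bl _)) scaler_sumr.
apply: eq_bigr => p _; rewrite -(sum_cop_weight_comp t' f' (Br _)).
by rewrite !scaler_sumr.
Qed.

Lemma weight_form_weight c t t' x y : has_weight t x -> has_weight t' y ->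
  weight_form c x y = c t t' * x 1%g * y 1%g.
Proof.
move=> xt yt; rewrite /weight_form.
rewrite (bigD1 t) //= [X in _ + X]big1 ?addr0; last first.
  move=> u /negPf nu; apply: big1 => u' _.
  by rewrite (weight_comp_weight u xt) nu scale0r !ffunE mulr0 mul0r.
rewrite (bigD1 t') //= [X in _ + X]big1 ?addr0; last first.
  move=> u /negPf nu.
  by rewrite (weight_comp_weight u yt) nu scale0r !ffunE mulr0.
by rewrite (weight_comp_weight t xt) (weight_comp_weight t' yt) !eqxx !scale1r.
Qed.

Lemma weight_form1l c y : (forall t, c 1%g t = 1) -> weight_form c 1 y = y 1%g.
Proof.
move=> c1; rewrite -{1}[y]sum_weight_comp.
rewrite (lin_sumE _ _ ((weight_form_bilinear c).2 1)).
rewrite -[in RHS](sum_weight_comp y) sum_ffunE; apply: eq_bigr => t _.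
rewrite (weight_form_weight c has_weight1 (@weight_compP t y)) c1 !mul1r.
by rewrite ffunE mul1r.
Qed.

Lemma weight_form1r c x : (forall t, c t 1%g = 1) -> weight_form c x 1 = x 1%g.
Proof.
move=> c1; rewrite -{1}[x]sum_weight_comp.
rewrite (lin_sumE _ _ ((weight_form_bilinear c).1 1)).
rewrite -[in RHS](sum_weight_comp x) sum_ffunE; apply: eq_bigr => t _.
rewrite (weight_form_weight c (@weight_compP t x) has_weight1) c1 mul1r.
by rewrite [(1 : kG) _]ffunE mulr1.
Qed.

Local Notation H := (funHopf k gT).

Lemma conv_weight_form c d f f' :
  conv (H := H) (weight_form c) (weight_form d) f f'
  = weight_form (fun t t' => c t t' * d t t') f f'.
Proof.
rewrite /conv (@sum_cop_weight_form k^o _ c f f' (weight_form_bilinear d)).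
do 2!apply: eq_bigr => ? _.
rewrite (weight_form_weight d (@weight_compP _ _) (@weight_compP _ _)).
by rewrite -[_ *: _]/(_ * _) !mulrA.
Qed.

(** The E_t sum to the counit, so the constant coefficient 1 gives the unit for convolution. *)
Lemma weight_form_cst1 f f' : weight_form (fun _ _ => 1) f f' = f 1%g * f' 1%g.
Proof.
rewrite /weight_form -{2}[f]sum_weight_comp -{2}[f']sum_weight_comp !sum_ffunE.
rewrite mulr_suml; apply: eq_bigr => t _; rewrite mulr_sumr.
by apply: eq_bigr => t' _; rewrite mul1r.
Qed.

Lemma weight_form_cocycle : hopf_cocycle (H := H) (weight_form e).
Proof.
split.
- exact: weight_form_bilinear.
- exists (weight_form (fun t t' => (e t t')^-1)).
    exact: weight_form_bilinear.
  move=> f f'; rewrite !conv_weight_form; split;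
    rewrite -[RHS]/(f 1%g * f' 1%g) -weight_form_cst1;
    do 2!apply: eq_bigr => ? _.
    by rewrite mulfV ?eta_neq0.
  by rewrite mulVf ?eta_neq0.
- by move=> f; apply: weight_form1l => t; exact: eta1g.
- by move=> f; apply: weight_form1r => t; exact: etag1.
- move=> a b c.
  have wfb := weight_form_bilinear e.
  have Bl : bilinear_map (fun x y : kG => weight_form e (x * y) c : k^o).
    by split=> z; apply: (lin_bill _ wfb);
      [apply: lin_mull | apply: lin_mulr]; apply: lin_id.
  have Br : bilinear_map (fun x y : kG => weight_form e a (x * y) : k^o).
    by split=> z; apply: (lin_bilr _ wfb);
      [apply: lin_mull | apply: lin_mulr]; apply: lin_id.
  rewrite (sum_cop_weight_form e a b Bl) (sum_cop_weight_form e b c Br).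
  (* Splitting all three arguments by weight, a_t b_u has weight tu and b_u c_w has weight uw, so
     the two sides differ only by [etaA]. *)
  transitivity (\sum_t \sum_u \sum_w e t u * e (t * u)%g w *
    (weight_comp t a 1%g * weight_comp u b 1%g * weight_comp w c 1%g)).
    apply: eq_bigr => t _; apply: eq_bigr => u _.
    rewrite -{1}[c]sum_weight_comp (lin_sumE _ _ (wfb.2 _)) scaler_sumr.
    apply: eq_bigr => w _; rewrite (weight_form_weight e
      (has_weightM (@weight_compP t a) (@weight_compP u b)) (@weight_compP w c)).
    by rewrite [(_ * _ : kG) _]ffunE -[_ *: _]/(_ * _) !mulrA.
  rewrite exchange_big; apply: eq_bigr => u _ /=.
  rewrite exchange_big; apply: eq_bigr => w _ /=.
  rewrite -{2}[a]sum_weight_comp (lin_sumE _ _ (wfb.1 _)) scaler_sumr.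
  apply: eq_bigr => t _; rewrite (weight_form_weight e
    (@weight_compP t a) (has_weightM (@weight_compP u b) (@weight_compP w c))).
  by rewrite [(_ * _ : kG) _]ffunE -[_ *: _]/(_ * _) etaA !mulrA.
Qed.

Lemma twmul_weight_form f f' :
  twmul (H := H) (weight_form e) f f'
  = \sum_t \sum_t' e t t' *: (weight_comp t f * weight_comp t' f') :> kG.
Proof.
apply: (sum_cop_weight_form (X := kG) (B := fun x y => x * y)).
by split=> z; [apply: lin_mull | apply: lin_mulr]; apply: lin_id.
Qed.

Lemma weight_comp_sum (I : finType) (F : I -> kG) t :
  weight_comp t (\sum_i F i) = \sum_i weight_comp t (F i).
Proof. exact: (lin_sumE _ _ (weight_comp_linear t)). Qed.

(** * The isomorphism with R(S, eta) *)

Definition weight_val f (g : gT) : twGroupAlg e := [ffun t => weight_comp t f g].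

Lemma weight_val_twmul f f' g :
  weight_val (twmul (H := H) (weight_form e) f f') g
  = weight_val f g * weight_val f' g.
Proof.
have scE (a : k) (b : k^o) : a *: b = a * b by [].
apply/ffunP => u; rewrite ffunE [RHS]ffunE twmul_weight_form.
rewrite weight_comp_sum sum_ffunE; apply: eq_bigr => t _.
rewrite weight_comp_sum sum_ffunE.
(* For fixed t, the product f_t f'_t' has weight tt', so only t' = t^-1 u contributes to the
   coordinate u. *)
rewrite -[RHS](sum_pick (fun t' => e t t' * weight_val f g t * weight_val f' g t')
  (t^-1 * u)%g).
apply: eq_bigr => t' _; rewrite (linZE _ _ (weight_comp_linear u)).
rewrite (weight_comp_weight u
  (has_weightM (@weight_compP t f) (@weight_compP t' f'))).
rewrite [X in X = _]ffunE [X in _ *: X]ffunE [X in _ *: (_ *: X)]ffunE !scE.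
rewrite ![weight_val _ _ _]ffunE mulrCA mulrA -(inj_eq (mulgI t) t') mulKVg.
by rewrite eq_sym !mulrA.
Qed.

Hypothesis abS : abelian S.

Lemma subg_mulC (s t : subg_of S) : (s * t = t * s)%g.
Proof. by apply: val_inj; apply: (centsP abS); apply: valP. Qed.

Fact weight_map_subproof f :
  ([ffun g => weight_val f g] : mapAlg gT (twGroupAlg e)) \in @ind_pred _ _ _ e.
Proof.
apply/ind_predP => s g; apply/ffunP => t.
rewrite (tg_act_coord subg_mulC) !ffunE.
by have := weight_compP t f s g; rewrite !ffunE.
Qed.

Definition weight_map f : indAlg e := IndAlg (weight_map_subproof f).

Definition coord_sum (r : indAlg e) : kG := [ffun g => \sum_t ind_val r g t].

Lemma weight_mapE f g t : ind_val (weight_map f) g t = weight_comp t f g.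
Proof. by rewrite !ffunE. Qed.

Lemma weight_map_linear : linear weight_map.
Proof.
move=> c x y; apply: ind_eq => g; apply/ffunP => t.
by rewrite weight_mapE weight_comp_linear !ffunE.
Qed.

Lemma weight_map1 : weight_map 1 = 1.
Proof.
apply: ind_eq => g; apply/ffunP => t.
rewrite weight_mapE (weight_comp_weight t has_weight1) !ffunE.
by rewrite -[LHS]/(_ * _) mulr1.
Qed.

Lemma weight_map_twmul f f' :
  weight_map (twmul (H := H) (weight_form e) f f')
  = weight_map f * weight_map f'.
Proof. by apply: ind_eq => g; rewrite !ffunE weight_val_twmul. Qed.

Lemma weight_mapK : cancel weight_map coord_sum.
Proof.
move=> f; apply/ffunP => g; rewrite -[in RHS](sum_weight_comp f) sum_ffunE ffunE.
by apply: eq_bigr => t _; rewrite weight_mapE.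
Qed.

(** Equivariance of r says that its coordinate at t has weight t, so the coordinates are the weight
    components of their own sum. *)
Lemma coord_sumK : cancel coord_sum weight_map.
Proof.
move=> r; pose x t : kG := [ffun g => ind_val r g t].
have xP t : has_weight t (x t).
  move=> s g; rewrite ffunE (ind_predP _ (ind_valP r)).
  by rewrite (tg_act_coord subg_mulC) ffunE.
have -> : coord_sum r = \sum_t x t.
  apply/ffunP => g; rewrite sum_ffunE ffunE.
  by apply: eq_bigr => t _; rewrite ffunE.
apply: ind_eq => g; apply/ffunP => t.
rewrite weight_mapE weight_comp_sum sum_ffunE.
under eq_bigr do rewrite (weight_comp_weight t (xP _)) !ffunE.
exact: (sum_delta (fun u => ind_val r g u : k^o)).
Qed.

Lemma weight_map_bij : bijective weight_map.
Proof. exact: Bijective weight_mapK coord_sumK. Qed.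

(** Components are averages of left translates, which commute with right translation. *)
Lemma weight_map_move g f :
  weight_map [ffun h => f (h * g)%g] = ind_move g (weight_map f).
Proof.
apply: ind_eq => h; apply/ffunP => t; rewrite weight_mapE ind_moveE weight_mapE.
by rewrite !ffunE; congr (_ * _); apply: eq_bigr => r _; rewrite ffunE mulgA.
Qed.

End WeightComponents.

Theorem lemma3p3 (k : closedFieldType) (char0 : [pchar k] =i pred0)
    (gT : finGroupType) (S : {group gT})
    (nSG : (S <| [set: gT])%g) (abS : abelian S)
    (eta : cocycle2 k (subg_of S)) (nd : nondegenerate_cocycle eta)
    (etaV : forall s : subg_of S, eta s s^-1%g = 1) :
  exists alphaZ2 : hopf_cocycle (H := funHopf k gT) (alpha eta),
    comodAlg_iso (cotwist alphaZ2) (indComod eta).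
Proof.
have nz_S : #|S|%:R != 0 :> k.
  by rewrite ((pcharf0P k).1 char0) -lt0n cardG_gt0.
have alphaZ2 : hopf_cocycle (H := funHopf k gT) (alpha eta).
  apply: eq_hopf_cocycle (weight_form_cocycle nd nz_S) => f f'.
  exact/esym/alphaE.
exists alphaZ2; pose phi := weight_map nd abS.
have phi_linear : linear phi by exact: weight_map_linear.
apply: (comodAlg_isoI (A := cotwist alphaZ2) (B := indComod eta) (f := phi)).
- exact: phi_linear.
- exact: weight_map1.
(* The product of [cotwist] is built from [alpha], which agrees with the weight form only pointwise,
   hence the rewriting under the sums. *)
- move=> x y; rewrite -(weight_map_twmul nd nz_S).
  congr phi; apply: eq_bigr => p _; apply: eq_bigr => q _.
  by rewrite alphaE.
- exact: weight_map_bij.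
move=> f X b bl; rewrite big_map ind_coact_sum /=.
rewrite (kG_cop_right_translate (B := fun x y => b (phi x) y)).
  by apply: eq_bigr => g _; rewrite /phi weight_map_move.
by split=> z; [apply: (lin_bill _ bl) | apply: (lin_bilr _ bl)].
Qed.
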